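(* Let $\sigma,\lambda>0$ be constants and let $f$ be a probability density on $\mathbb{R}$ with $f\in C^2([a,b])$ for some $a<0<b$, $f(0)\neq0$ and $f''(0)\ne0$. For $h>0$, let $\widetilde B^*=\widetilde B^*(h)$ be the minimizer over $B\ge0$ of $$B\mapsto\frac{2}{\lambda\sqrt{2\pi h^3\sigma^2}}\exp\left(-\frac{B^2}{2h\sigma^2}\right)+2f(0)B.$$ Then, as $h\to0$, $$\widetilde B^*=\sqrt{4h\sigma^2\log(1/h)}+O\left(\sqrt{h\log\log(1/h)}\right).$$
   Context: The displayed function of $B$ is the leading-order term of the error $E_2=f^*_{|\Delta X|\,|\,|\Delta X|>B}(B)-2f(0)$, where $\Delta X$ is an increment over a time interval of length $h$ of the process $X_t=\gamma t+\sigma W_t+\sum_{j=1}^{N_t}\zeta_j$ ($W$ a Wiener process, $N$ an independent Poisson process of intensity $\lambda$, $\zeta_j$ i.i.d. with density $f$ and independent of $W,N$), and $f^*_{|\Delta X|\,|\,|\Delta X|>B}$ is the density of $|\Delta X|$ conditioned on $|\Delta X|>B$. *)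

(* Defs.v *)
From HB Require Import structures.
From mathcomp Require Import all_boot all_order all_algebra.
From mathcomp Require Import all_classical all_reals all_analysis.
Set Implicit Arguments.
Unset Strict Implicit.
Unset Printing Implicit Defensive.
Import Order.TTheory GRing.Theory Num.Theory.
Import numFieldNormedType.Exports.
Local Open Scope classical_set_scope.
Local Open Scope ring_scope.

Definition probability_density (R : realType) (f : R -> R) : Prop :=
  [/\ measurable_fun [set: R] f,
      forall x, 0 <= f x &
      (\int[@lebesgue_measure R]_x (f x)%:E = 1)%E].

(* The limit is taken inside D, so that on D = [a, b] the derivative is
   one-sided at the two endpoints and two-sided in between. *)
Definition derivative_on (R : realType) (D : set R) (f g : R -> R) : Prop :=
  forall x, D x -> (f y - f x) / (y - x) @[y --> within D x^'] --> g x.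

Definition C2_on (R : realType) (a b : R) (f : R -> R) : Prop :=
  exists f1 f2 : R -> R,
    [/\ derivative_on `[a, b] f f1,
        derivative_on `[a, b] f1 f2 &
        {within `[a, b], continuous f2}].

Definition leading_error (R : realType) (sigma lambda : R) (f : R -> R)
    (h B : R) : R :=
  2 / (lambda * Num.sqrt (2 * pi * h ^+ 3 * sigma ^+ 2)) *
    expR (- (B ^+ 2 / (2 * h * sigma ^+ 2))) + 2 * f 0 * B.

(* A minimizer always exists when f 0 > 0, and it is unique for all small h, but
   for some larger h the value at B = 0 may tie with an interior minimum. *)
Definition minimizer_ge0 (R : realType) (F : R -> R) (B : R) : Prop :=
  0 <= B /\ forall B', 0 <= B' -> F B <= F B'.

(* Main.v *)
(* Write L = ln (1/h), b = sqrt (4 h sigma^2 L), c = f 0.  The objective is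
   F B = K h^(-3/2) exp (- B^2 / (2 h sigma^2)) + 2 c B with K independent of h,
   and its exponential term at b is K sqrt h.  Everything follows from comparing
   the minimal value F B with F b, without differentiating F:
   - dropping the exponential term of F B gives B <= b + K sqrt h / (2 c);
   - dropping the linear term of F B bounds the exponential by O(h^2 L); taking
     logarithms, b^2 - B^2 = O(h ln L), and (b - B)^2 <= b^2 - B^2 if B < b. *)
Require Import Defs.
From HB Require Import structures.
From mathcomp Require Import all_boot all_order all_algebra.
From mathcomp Require Import all_classical all_reals all_analysis.
From mathcomp Require Import ring lra.
Set Implicit Arguments.
Unset Strict Implicit.
Unset Printing Implicit Defensive.
Import Order.TTheory GRing.Theory Num.Theory.
Import numFieldNormedType.Exports.
Local Open Scope classical_set_scope.
Local Open Scope ring_scope.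

(** Non-asymptotic form, with a constant free of [h], so it serves as the big-O constant. Its
    summand [K / (2 * c)] comes from the upper estimate on [B], the square root from the lower one;
    adding them covers both signs. *)
Lemma minimizer_dist_le (R : realType) (K c s h B : R) :
  0 < K -> 0 < c -> 0 < s -> 0 < h -> 1 <= ln (ln h^-1) ->
  minimizer_ge0 (fun x => K / (h * Num.sqrt h) *
    expR (- (x ^+ 2 / (2 * h * s ^+ 2))) + 2 * c * x) B ->
  `|B - Num.sqrt (4 * h * s ^+ 2 * ln h^-1)| <=
    (K / (2 * c) + Num.sqrt (2 * s ^+ 2 * (1 + ln ((K + 4 * c * s) / K)))) *
    Num.sqrt (h * ln (ln h^-1)).
Proof.
move=> K0 c0 s0 h0; set L := ln h^-1; set l := ln L => l1 [B0 Bmin].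
(* [ln] takes the value 0 on nonpositive arguments, so [L <= 0] would force [l = 0]. *)
have L0 : 0 < L by rewrite ltNge; apply/negP => /ln0; rewrite -/l; lra.
have L2 : 2 <= L.
  by rewrite -(lnK L0) -/l; have := expR_ge1Dx l; lra.
have L1 : 1 <= L by rewrite (le_trans _ L2) ?ler1n.
have eL : expR (- L) = h by rewrite /L lnV // opprK lnK.
set r := Num.sqrt h.
have r0 : 0 < r by rewrite sqrtr_gt0.
have rr : h = r ^+ 2 by rewrite sqr_sqrtr // ltW.
set b := Num.sqrt (4 * h * s ^+ 2 * L).
have b0 : 0 <= b by exact: sqrtr_ge0.
have bb : b ^+ 2 = 4 * h * s ^+ 2 * L.
  by rewrite sqr_sqrtr // !mulr_ge0 // ?sqr_ge0 // ltW.
have s_neq0 : s != 0 by rewrite gt_eqF.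
have h_neq0 : h != 0 by rewrite gt_eqF.
have r_neq0 : r != 0 by rewrite gt_eqF.
have K_neq0 : K != 0 by rewrite gt_eqF.
have c_neq0 : c != 0 by rewrite gt_eqF.
set q := Num.sqrt (h * l).
have rq : r <= q by rewrite ler_sqrt ?ler_peMr ?mulr_ge0 // ltW // (lt_le_trans _ l1).
have := Bmin _ b0.
(* The choice of [b] makes the exponential equal to [h ^+ 2] there, which leaves [K * r] after the
   prefactor. *)
have -> : b ^+ 2 / (2 * h * s ^+ 2) = L + L by rewrite bb; field; apply/andP.
rewrite opprD expRD eL.
have -> : K / (h * r) * (h * h) = K * r by rewrite rr; field.
set u := B ^+ 2 / _ => hB.
have e0 : 0 < expR (- u) by exact: expR_gt0.
have A0 : 0 < K / (h * r) by rewrite divr_gt0 // mulr_gt0.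
have upper : B - b <= K / (2 * c) * q.
  have : 2 * c * (B - b) <= K * r.
    have : 0 <= K / (h * r) * expR (- u) by rewrite mulr_ge0 // ltW.
    lra.
  rewrite -ler_pdivlMl ?mulr_gt0 // => /le_trans; apply.
  rewrite mulrCA [leLHS]mulrA ler_pM2l //.
  by rewrite divr_gt0 // mulr_gt0.
set M := (K + 4 * c * s) / K.
have cs0 : 0 < c * s by rewrite mulr_gt0.
have M1 : 1 <= M by rewrite ler_pdivlMr //; lra.
have M0 : 0 < M by lra.
(* Replacing the root of [L] by [L] is harmless: only the logarithm of this bound matters, so the
   loss is a constant factor on [l]. *)
have bL : b <= 2 * s * r * L.
  rewrite -(@ler_pXn2r _ 2) ?nnegrE ?mulr_ge0 ?(ltW s0) ?(ltW r0) ?(ltW L0) //.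
  rewrite bb rr.
  have -> : (2 * s * r * L) ^+ 2 = 4 * r ^+ 2 * s ^+ 2 * L * L by ring.
  by rewrite ler_peMr // !mulr_ge0 // ltW.
(* With [1 <= L], the value at [b] is at most [(K + 4 * c * s) * r * L]; dividing by [K / (h * r)]
   produces [M]. *)
have eu : expR (- u) <= M * (h * h) * L.
  have : K / (h * r) * expR (- u) <= K * r * L + 4 * c * s * r * L.
    have : 0 <= 2 * c * B by rewrite !mulr_ge0 // ltW.
    have : 2 * c * b <= 2 * c * (2 * s * r * L) by rewrite ler_pM2l // mulr_gt0.
    have : K * r <= K * r * L by rewrite ler_peMr // mulr_ge0 // ltW.
    lra.
  rewrite -ler_pdivlMl //; congr (_ <= _); rewrite /M rr; field.
  by rewrite K_neq0.
clearbody M.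
have hu : 2 * L - l - ln M <= u.
  have : ln (expR (- u)) <= ln (M * (h * h) * L).
    by rewrite ler_ln ?posrE ?(lt_le_trans e0).
  rewrite expRK !lnM ?posrE ?mulr_gt0 // -/l.
  have -> : ln h = - L by rewrite /L lnV // opprK.
  lra.
have lnM0 : 0 <= ln M by rewrite ln_ge0.
have lower : b - B <= Num.sqrt (2 * s ^+ 2 * (1 + ln M)) * q.
  have [bB|Bb] := leP b B.
    by rewrite (@le_trans _ _ 0) ?mulr_ge0 ?sqrtr_ge0 // subr_le0.
  have ? : 0 <= 1 + ln M by rewrite addr_ge0.
  rewrite -sqrtrM; last by rewrite !mulr_ge0 // ltW.
  rewrite -[b - B]ger0_norm ?subr_ge0 ?(ltW Bb) // -sqrtr_sqr.
  rewrite ler_sqrt; last first.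
    by rewrite !mulr_ge0 // ltW // (lt_le_trans _ l1).
  have Bu : B ^+ 2 = 2 * h * s ^+ 2 * u by rewrite /u; field; apply/andP.
  have hs0 : 0 < 2 * h * s ^+ 2 by rewrite !mulr_gt0 // exprn_gt0.
  have h1 : 2 * h * s ^+ 2 * (2 * L - l - ln M) <= B ^+ 2.
    by rewrite Bu (ler_pM2l hs0).
  (* Since [1 <= l], the constant [ln M] is absorbed into a multiple of [l], whence the factor
     [1 + ln M]. *)
  have h2 : 2 * h * s ^+ 2 * ln M <= 2 * h * s ^+ 2 * (ln M * l).
    by rewrite ler_pM2l // ler_peMr.
  have h3 : (b - B) ^+ 2 <= b ^+ 2 - B ^+ 2.
    have : 0 <= B * (b - B) by rewrite mulr_ge0 // subr_ge0 ltW.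
    lra.
  rewrite (le_trans h3) // bb.
  lra.
have q0 : 0 <= q by exact: sqrtr_ge0.
have k1 : 0 <= K / (2 * c) * q by rewrite mulr_ge0 // divr_ge0 ?mulr_ge0 // ltW.
have k2 : 0 <= Num.sqrt (2 * s ^+ 2 * (1 + ln M)) * q.
  by rewrite mulr_ge0 ?sqrtr_ge0.
by rewrite ler_norml mulrDl; apply/andP; split; lra.
Qed.

Theorem corollary2p9 (R : realType) (sigma lambda a b : R) (f Bstar : R -> R)
  (sigma_gt0 : 0 < sigma) (lambda_gt0 : 0 < lambda)
  (f_density : probability_density f)
  (a_lt0 : a < 0) (b_gt0 : 0 < b) (f_C2 : C2_on a b f)
  (f0_neq0 : f 0 != 0) (f''0_neq0 : derive1n 2 f 0 != 0)
  (Bstar_min : forall h, 0 < h ->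
     minimizer_ge0 (leading_error sigma lambda f h) (Bstar h)) :
  Bstar = (fun h => Num.sqrt (4 * h * sigma ^+ 2 * ln (1 / h)))
    +O_ (0^'+) (fun h => Num.sqrt (h * ln (ln (1 / h)))).
Proof.
have f0_gt0 : 0 < f 0 by case: f_density => _ f_ge0 _; rewrite lt0r f0_neq0 f_ge0.
set K := 2 / (lambda * Num.sqrt (2 * pi * sigma ^+ 2)).
have K_gt0 : 0 < K.
  by rewrite divr_gt0 // mulr_gt0 // sqrtr_gt0 !mulr_gt0 ?pi_gt0 // exprn_gt0.
apply/eqaddOP; near=> k.
(* Below this threshold [ln h^-1] is at least e, which is exactly [1 <= ln (ln h^-1)]. *)
have h0_gt0 : 0 < expR (- expR 1) :> R by exact: expR_gt0.
near=> h.
have h_gt0 : 0 < h by near: h; exact: nbhs_right_gt.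
have h_lt : h <= expR (- expR 1) by near: h; exact: nbhs_right_le.
have L_ge : expR 1 <= ln h^-1.
  by rewrite lnV // lerNr -[leRHS]expRK ler_ln ?posrE.
have l_ge1 : 1 <= ln (ln h^-1).
  by rewrite -[leLHS]expRK ler_ln ?posrE ?expR_gt0 // (lt_le_trans _ L_ge) ?expR_gt0.
have coefE : 2 / (lambda * Num.sqrt (2 * pi * h ^+ 3 * sigma ^+ 2)) =
    K / (h * Num.sqrt h).
  have -> : 2 * pi * h ^+ 3 * sigma ^+ 2 =
      (2 * pi * sigma ^+ 2) * (h ^+ 2 * h) by ring.
  rewrite sqrtrM ?mulr_ge0 ?pi_ge0 ?(ltW sigma_gt0) //.
  rewrite (sqrtrM h (sqr_ge0 h)) sqrtr_sqr ger0_norm ?ltW //.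
  by rewrite /K -[RHS]mulrA -invfM !mulrA.
have := Bstar_min h h_gt0; rewrite /leading_error coefE.
move=> /(minimizer_dist_le K_gt0 f0_gt0 sigma_gt0 h_gt0 l_ge1) dist_le.
rewrite !fctE div1r [X in _ <= _ * X]ger0_norm ?sqrtr_ge0 //.
(* What remains is that [k] exceeds the constant of the lemma; [k] is fixed before [h], which is
   legitimate because that constant does not involve [h]. *)
apply: (le_trans dist_le); rewrite ler_wpM2r ?sqrtr_ge0 //.
Unshelve. all: by end_near.
Qed.
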